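(* Let $n\ge 2$ be an integer, let $b=-n+i$, and let $D\subset\{0,1,\ldots,|b|^2-1\}$ be nonempty with $|d-d'|\neq 1$ for all $d,d'\in D$. If $A\subset D^{\mathbb N}$ is a nonempty subshift and $\tilde A=\{\sum_{k=1}^\infty a_k b^{-k} : (a_k)_{k\ge1}\in A\}$, then (i) $\tilde A$ is $\times b$-invariant, and (ii) $\dim_B\tilde A=\dfrac{\mathcal E(A)}{\log|b|}$ (in particular the box-counting dimension exists). Moreover, (iii) if $Y\subset C_D$ is a $\times b$-invariant set, then $\dim_H Y=\dim_B Y$.
   Context: Here $|b|^2=n^2+1$ and $C_D=\{\sum_{k\ge1}d_kb^{-k}\in\mathbb C : d_k\in D\}$. Subshift: give $D$ the discrete topology and $D^{\mathbb N}$ the product topology, and let $\sigma:D^{\mathbb N}\to D^{\mathbb N}$, $(\omega_k)_{k\ge1}\mapsto(\omega_{k+1})_{k\ge1}$ be the left shift. A set $A\subset D^{\mathbb N}$ is a subshift if it is closed and $\sigma(A)\subset A$. Topological entropy: $\mathcal E(A)=\lim_{m\to\infty}\frac{\log|\mathcal L_m(A)|}{m}$, where $\mathcal L_m(A)$ is the set of words $(a_1,\ldots,a_m)$ that are the first $m$ entries of some sequence in $A$. $\times b$-invariance: let $\pi:D^{\mathbb N}\to C_D$, $\pi((d_k)_{k\ge1})=\sum_{k\ge1}d_kb^{-k}$. Under the stated condition on $D$ the map $\pi$ is a bijection, and $T:C_D\to C_D$ is defined by $T=\pi\circ\sigma\circ\pi^{-1}$. A nonempty closed subset $Y\subset C_D$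 is $\times b$-invariant if $T(Y)\subset Y$. $\dim_H$ is Hausdorff dimension. $\dim_BV=\lim_{\delta\to0^+}\frac{\log N_\delta(V)}{-\log\delta}$ is the box-counting dimension (when the limit exists), where $N_\delta(V)$ is the minimum number of sets of diameter at most $\delta$ needed to cover $V$. *)

(* Defs.v *)
From HB Require Import structures.
From mathcomp Require Import all_boot all_order all_algebra.
From mathcomp Require Import complex.
From mathcomp Require Import all_classical all_reals all_analysis.

Set Implicit Arguments.
Unset Strict Implicit.
Unset Printing Implicit Defensive.

Import Order.TTheory GRing.Theory Num.Theory numFieldNormedType.Exports.

Local Open Scope classical_set_scope.
Local Open Scope ring_scope.

Section Dimensions.
Context {R : realType}.
Implicit Types (V U : set R[i]^o) (s delta : R).

(* [maxe 0] only matters for the empty set, whose [ereal_sup] is -oo. *)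
Definition diam U : \bar R :=
  maxe 0%E (ereal_sup [set (ComplexField.Normc.normc (x - y))%:E | x in U & y in U]).

(* The empty set has weight 0 also for [s = 0], where [0 `^ 0 = 1]. *)
Definition diam_pow s U : \bar R :=
  if U == set0 then 0%E else (diam U `^ s)%E.

Definition hausdorff_premeasure s delta V : \bar R :=
  ereal_inf [set (\sum_(0 <= k <oo) diam_pow s (U k))%E |
    U in [set U : nat -> set R[i]^o |
      V `<=` \bigcup_k U k /\ forall k, (diam (U k) <= delta%:E)%E]].

Definition hausdorff_measure s V : \bar R :=
  ereal_sup [set hausdorff_premeasure s delta V |
    delta in [set delta : R | 0 < delta]].

Definition hausdorff_dim V : \bar R :=
  ereal_inf [set s%:E | s in [set s : R |
    0 <= s /\ hausdorff_measure s V = 0%E]].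

(* +oo when no finite family of sets of diameter at most [delta] covers [V]. *)
Definition covering_number V delta : \bar R :=
  ereal_inf [set m%:R%:E | m in [set m : nat |
    exists U : 'I_m -> set R[i]^o,
      V `<=` \bigcup_i U i /\ forall i, (diam (U i) <= delta%:E)%E]].

Definition box_ratio V delta : \bar R :=
  (lne (covering_number V delta) / (- ln delta)%:E)%E.

Definition box_dim_exists V : Prop := cvg (box_ratio V @ 0^'+).

(* Meaningful only when [box_dim_exists V] holds. *)
Definition box_dim V : \bar R := lim (box_ratio V @ 0^'+).

End Dimensions.

Section Subshifts.
Variables (N : nat) (D : {set 'I_N}).

Definition digit : Type := {d : 'I_N | d \in D}.

HB.instance Definition _ := Finite.on digit.

(* Sequences are indexed from 0: [a k] is the digit d_(k+1). *)
Definition digit_seq : Type := prod_topology (fun _ : nat => discrete_topology digit).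

HB.instance Definition _ := Topological.on digit_seq.

Implicit Types A : set digit_seq.

Definition shift (a : digit_seq) : digit_seq := fun k => a k.+1.

Definition subshift A : Prop := closed A /\ shift @` A `<=` A.

Definition language A (m : nat) : {set m.-tuple digit} :=
  [set w : m.-tuple digit |
    `[< exists2 a, A a & forall i : 'I_m, tnth w i = a i >]].

Definition entropy (R : realType) A : R :=
  limn (fun m : nat => ln (#|language A m|%:R : R) / m%:R).

Section Expansions.
Variables (R : realType) (b : R[i]).

Definition expansion (a : digit_seq) : R[i]^o :=
  limn (fun m : nat => \sum_(0 <= k < m) (\val (a k))%:R * b ^- k.+1 : R[i]^o).

Definition expansion_set : set R[i]^o := range expansion.

Lemma expansion_in (a : digit_seq) : expansion a \in expansion_set.
Proof. by apply/mem_set; exists a. Qed.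

Definition coding (a : digit_seq) : expansion_set :=
  exist _ (expansion a) (expansion_in a).

Definition decoding (z : expansion_set) : digit_seq :=
  s2val (cid2 (set_mem (valP z))).

(* The inverse of [coding], which exists exactly when [coding] is injective;
   in general only a right inverse. *)
Lemma decodingK : cancel decoding coding.
Proof.
by move=> z; apply: val_inj; rewrite /= /decoding; case: cid2.
Qed.

Definition expansion_shift : expansion_set -> expansion_set :=
  coding \o shift \o decoding.

Definition times_invariant (Y : set R[i]^o) : Prop :=
  [/\ Y !=set0, closed Y, Y `<=` expansion_set &
      forall z : expansion_set, Y (\val z) -> Y (\val (expansion_shift z))].

End Expansions.
End Subshifts.

(* Main.v *)
Require Import Defs.
From HB Require Import structures.
From mathcomp Require Import all_boot all_order all_algebra.
From mathcomp Require Import complex.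
From mathcomp Require Import all_classical all_reals all_analysis.
From mathcomp Require Import zify ring lra.

Set Implicit Arguments.
Unset Strict Implicit.
Unset Printing Implicit Defensive.

Import Order.TTheory GRing.Theory Num.Theory numFieldNormedType.Exports.
Import ComplexField.Normc.

Local Open Scope classical_set_scope.
Local Open Scope ring_scope.

Local Notation shift := (@Defs.shift _ _).

(** Write [c] for [|b|], so that [c ^ 2 = n ^ 2 + 1], and [pi] for the map that
    sends a digit sequence to its expansion.  Shifting a sequence [a] by [m]
    places amounts to multiplying its expansion by [b ^ m] and removing a
    Gaussian integer:
      [b ^ m * pi a = s_m a + pi (shift ^ m a)],
    where [s_m a] is the Gaussian integer whose digits in base [b] are the first
    [m] digits of [a] (see [carry] and [expansion_carry]).  As [pi] is bounded,
    the geometry of [pi(A)] at scale [c ^ - m] is that of the Gaussian integers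
    [s_m a].

    Injectivity of [pi] ([expansion_inj]).  If [pi a = pi a'], the Gaussian
    integers [s_m a - s_m a'] stay bounded.  Their second coordinates [y_m] in
    the basis [(1, b)] satisfy
      [y_(m+2) + 2 n y_(m+1) + (n ^ 2 + 1) y_m = a_m - a'_m],
    with a right-hand side of absolute value at most [n ^ 2].  A bounded integer
    sequence of this kind takes a value in [{-1, 0, 1}] after two successive
    zeros ([recurrence_after_zeros]); thus, as long as [a] and [a'] agree, their
    next digits differ by at most [1], and the hypothesis on [D] makes them
    equal.  So [pi] is an embedding of a compact space that conjugates the shift
    to [T], and the invariant sets are exactly the images of the nonempty
    subshifts ([subshift_times_invariant], [times_invariant_subshift]).

    Box dimension.  The image of a cylinder of length [m] has diameter of order
    at most [c ^ - m].  Conversely a set of diameter at most [c ^ - m] meets the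
    images of at most [K] such cylinders, with [K] independent of [m]: their
    Gaussian integers [s_m] are distinct and lie in a disc of fixed radius
    ([card_words_meeting]).  So the covering number at a scale between
    [c ^ - (m + 1)] and [c ^ - m] is, up to bounded factors, the number of words
    of length [m] of the subshift, whose logarithm grows like [m] times the
    entropy by subadditivity ([box_dim_expansion]).

    Hausdorff dimension.  Covering by all cylinders of one length gives the upper
    bound.  For the lower bound, let the [s]-dimensional measure of [pi(A)]
    vanish, and take a cover with a very small [s]-sum.  Replacing each of its
    members by the at most [K] cylinders of comparable size that it meets, and
    using compactness, one gets finitely many lengths [l_k] with
    [sum_k K * c ^ (- s * l_k) <= 1] such that every sequence of [A] starts with
    one of at most [K] words of length [l_k], for some [k].  What follows this
    word is again in [A], hence the numbers of words satisfy
    [L_M <= sum_k K * L_(M - l_k)]; this forces [L_M] to be at most of order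
    [c ^ (s * M)] ([renewal_bound]), so the entropy is at most [s * log c]
    ([entropy_le_of_hausdorff_null]). *)

(** * Bounded integer solutions of the carry recurrence *)

Section Recurrence.
Variables (n : nat) (y : nat -> int) (B : nat).
Hypothesis n_ge2 : (2 <= n)%N.
Hypothesis y_bounded : forall m, (`|y m| <= B)%N.
Hypothesis y_rec : forall m,
  `|y m.+2 + 2 * n%:Z * y m.+1 + (n%:Z ^+ 2 + 1) * y m| <= n%:Z ^+ 2.

(** Multiplying the characteristic polynomial [z ^ 2 + 2 n z + (n ^ 2 + 1)] by
    [(n ^ 2 + 1) - 2 n z] cancels the term of degree one.  The constant
    coefficient then exceeds the sum of the absolute values of the others; in the
    original recurrence the two are equal for [n = 2]. *)
Lemma recurrence_contraction M : (forall m, `|y m| <= M) -> forall m,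
  (n%:Z ^+ 2 + 1) ^+ 2 * `|y m| <=
  (3 * n%:Z ^+ 2 + 2 * n%:Z - 1) * M + n%:Z ^+ 2 * (n%:Z + 1) ^+ 2.
Proof.
move=> yM m; have e0 := y_rec m; have e1 := y_rec m.+1.
have N2 : (2 : int) <= n%:Z by lia.
move: (n%:Z) N2 e0 e1 => N N2.
set E0 := (X in `|X| <= _ -> _); set E1 := (X in _ -> `|X| <= _ -> _) => e0 e1.
have -> : (N ^+ 2 + 1) ^+ 2 * `|y m| = `|(N ^+ 2 + 1) ^+ 2 * y m|.
  by rewrite normrM ger0_norm// sqr_ge0.
have -> : (N ^+ 2 + 1) ^+ 2 * y m = (3 * N ^+ 2 - 1) * y m.+2
   + 2 * N * y m.+3 + (N ^+ 2 + 1) * E0 - 2 * N * E1.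
  by rewrite /E0 /E1; ring.
have h2 : `|(3 * N ^+ 2 - 1) * y m.+2| <= (3 * N ^+ 2 - 1) * M.
  by rewrite normrM ger0_norm ?ler_wpM2l//; nia.
have h3 : `|2 * N * y m.+3| <= 2 * N * M.
  by rewrite normrM ger0_norm ?ler_wpM2l//; nia.
have h4 : `|(N ^+ 2 + 1) * E0| <= (N ^+ 2 + 1) * N ^+ 2.
  by rewrite normrM ger0_norm ?ler_wpM2l//; nia.
have h5 : `|2 * N * E1| <= 2 * N * N ^+ 2.
  by rewrite normrM ger0_norm ?ler_wpM2l//; nia.
have -> : (3 * N ^+ 2 + 2 * N - 1) * M + N ^+ 2 * (N + 1) ^+ 2 =
 (3 * N ^+ 2 - 1) * M + 2 * N * M + (N ^+ 2 + 1) * N ^+ 2 + 2 * N * N ^+ 2.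
  by ring.
apply: le_trans (ler_normB _ _) _; rewrite lerD//.
apply: le_trans (ler_normD _ _) _; rewrite lerD//.
by apply: le_trans (ler_normD _ _) _; rewrite lerD.
Qed.

(** The least bound is attained, as the values are integers, so it satisfies
    the inequality of [recurrence_contraction]. *)
Lemma recurrence_bound : exists2 M : nat, (forall m, (`|y m| <= M)%N) &
  (M <= if n == 2%N then 3 else if n == 3%N then 2 else 1)%N.
Proof.
have exB : exists M, `[< forall m, (`|y m| <= M)%N >] by exists B; exact/asboolP.
have [M /asboolP yM Mmin] := ex_minnP exB; exists M => //.
have [m ymM] : exists m, (`|y m| = M)%N.
  apply: contrapT => nex; have ltM m : (`|y m| < M)%N.
    by rewrite ltn_neqAle yM andbT; apply/eqP => e; apply: nex; exists m.
  case: M yM Mmin ltM nex => [|M] _ Mmin ltM _; first by have := ltM 0%N.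
  have : (M.+1 <= M)%N by apply: Mmin; exact/asboolP.
  by rewrite ltnn.
have yM' k : `|y k| <= M%:Z by have := yM k; lia.
have := recurrence_contraction yM' m; have -> : `|y m| = M%:Z by lia.
case: eqP => [->|n2]; first by lia.
case: eqP => [->|n3]; first by lia.
rewrite leqNgt => ineq; apply/negP => M2.
have : (4 : int) <= n%:Z by lia.
have : (2 : int) <= M%:Z by lia.
by move: n%:Z M%:Z ineq => N K; nia.
Qed.

(** For [n >= 4] this is the bound of [recurrence_bound].  For [n = 2, 3] a value
    of absolute value at least [2] after two zeros would make the following one
    exceed that bound: it is [-2 n y_(m+2)] up to an error of at most [n ^ 2]. *)
Lemma recurrence_after_zeros m : y m = 0 -> y m.+1 = 0 -> `|y m.+2| <= 1.
Proof.
move=> y0 y1; have [M yM Mle] := recurrence_bound.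
have := yM m.+2; have := yM m.+3; have := y_rec m.+1; rewrite y1.
move: Mle; case: eqP => [->|_]; first by lia.
by case: eqP => [->|_]; lia.
Qed.

End Recurrence.

(** * Subadditive sequences *)

(** Fekete's lemma: along the Euclidean division [m = q * p + r], the quotient
    [u m / m] is at most [u p / p] up to an error tending to [0], while it is
    never below the infimum of all the [u p / p]. *)
Lemma subadditive_cvg (R : realType) (u : nat -> R) :
  (forall m, 0 <= u m) -> (forall m k, u (m + k)%N <= u m + u k) ->
  cvgn (fun m => u m / m%:R).
Proof.
move=> u0 uD.
pose S := [set u m.+1 / m.+1%:R | m in [set: nat]].
have S0 : lbound S 0 by move=> _ [m _ <-]; rewrite divr_ge0.
have hS : has_inf S by split; [exists (u 1%N / 1%:R); exists 0%N|exists 0].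
apply/cvg_ex; exists (inf S); apply/cvgrPdist_le => e e0.
have [_ [p _ <-] up] := inf_adherent (divr_gt0 e0 (ltr0Sn _ 1)) hS.
pose B := \sum_(j < p.+1) u j.
have uB r : (r < p.+1)%N -> u r <= B.
  by move=> rp; rewrite /B (bigD1 (Ordinal rp))//= lerDl sumr_ge0.
have B0 : 0 <= B by rewrite sumr_ge0.
have uq q r : u (q * p.+1 + r)%N <= q%:R * u p.+1 + u r.
  elim: q => [|q IH]; first by rewrite mul0n add0n mul0r add0r.
  rewrite mulSn -addnA (le_trans (uD _ _))// -natr1 mulrDl mul1r.
  by rewrite -addrA addrCA lerD2l.
near=> m.
have m0 : 0 < m%:R :> R by rewrite ltr0n; near: m; exists 1%N.
have infm : inf S <= u m / m%:R.
  apply: ge_inf; first by exists 0.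
  by exists m.-1 => //; rewrite prednK// -(ltr0n R).
rewrite distrC ger0_norm ?subr_ge0// lerBlDl.
have Bm : B / m%:R <= e / 2.
  rewrite ler_pdivrMr// mulrC -ler_pdivrMr ?divr_gt0//.
  by near: m; exact: nbhs_infty_ger.
have : u m <= m%:R * (u p.+1 / p.+1%:R) + B.
  rewrite {1}(divn_eq m p.+1) (le_trans (uq _ _))// lerD ?uB ?ltn_pmod//.
  rewrite mulrCA mulrC ler_wpM2l// ler_pdivlMr// -natrM ler_nat.
  exact: leq_trunc_div.
rewrite ler_pdivrMr// => /le_trans; apply.
rewrite (splitr e) addrA mulrDl mulrC lerD// ?ler_wpM2r// ?(ltW m0) ?(ltW up)//.
by rewrite -ler_pdivrMr.
Unshelve. all: by end_near.
Qed.

Lemma cvg_ratioP (R : realType) (u : nat -> R) (h : R) :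
  (fun m => u m / m%:R) @ \oo --> h ->
  forall e, 0 < e -> \forall m \near \oo, `|u m - m%:R * h| <= e * m%:R.
Proof.
move=> /cvgrPdist_le uh e e0; near=> m.
have m0 : 0 < m%:R :> R by rewrite ltr0n; near: m; exists 1%N.
have : `|h - u m / m%:R| <= e by near: m; exact: uh.
rewrite -(ler_pM2r m0); congr (_ <= _); rewrite -{2}(gtr0_norm m0) -normrM.
by rewrite mulrBl mulfVK ?gt_eqF// distrC (mulrC h).
Unshelve. all: by end_near.
Qed.

(** * Convergence of expansions *)

Section ComplexConvergence.
Variable R : realType.
Implicit Types (x y z : R[i]) (u : nat -> R[i]).

Lemma normc_ge0 x : 0 <= normc x.
Proof. by case: x => x1 x2; rewrite sqrtr_ge0. Qed.

Lemma normc_norm x : `|x| = (normc x)%:C%C.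
Proof. by case: x. Qed.

Lemma le_normc_ReIm x : normc x <= `|complex.Re x| + `|complex.Im x|.
Proof.
case: x => x1 x2 /=; rewrite -[leRHS]ger0_norm ?addr_ge0// -sqrtr_sqr.
by rewrite ler_wsqrtr// sqrrD !real_normK ?num_real// lerD2r lerDl mulrn_wge0 ?mulr_ge0.
Qed.

Lemma le_Re_normc x : `|complex.Re x| <= normc x.
Proof. by case: x => x1 x2 /=; rewrite -sqrtr_sqr ler_wsqrtr// lerDl sqr_ge0. Qed.

Lemma le_Im_normc x : `|complex.Im x| <= normc x.
Proof. by case: x => x1 x2 /=; rewrite -sqrtr_sqr ler_wsqrtr// lerDr sqr_ge0. Qed.

Lemma normc_natr k : normc (k%:R : R[i]) = k%:R.
Proof.
have -> : (k%:R : R[i]) = k%:R%:C%C by rewrite rmorph_nat.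
by rewrite /= expr0n/= addr0 sqrtr_sqr ger0_norm.
Qed.

Lemma normcX x k : normc (x ^+ k) = normc x ^+ k.
Proof.
elim: k => [|k IH]; last by rewrite !exprS normcM IH.
by rewrite !expr0 normc1.
Qed.

(** The norm of [R[i]] takes its values in [R[i]]; this brings convergence back
    to a real modulus. *)
Lemma complex_cvg_normc (T : Type) (F : set_system T) (FF : Filter F)
    (f : T -> R[i]^o) (l : R[i]^o) :
  (forall e : R, 0 < e -> \forall t \near F, normc (l - f t) < e) ->
  f @ F --> l.
Proof.
move=> H; apply/cvgrPdist_lt => e e0.
have eE : e = (complex.Re e)%:C%C by rewrite RRe_real// gtr0_real.
have e0' : 0 < complex.Re e by move: e0; rewrite {1}eE ltcR.
near=> t; rewrite normc_norm eE ltcR; near: t; exact: H.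
Unshelve. all: by end_near.
Qed.

Lemma complex_cvgP u (l : R[i]^o) :
  (u : nat -> R[i]^o) @ \oo --> l ->
  forall e : R, 0 < e -> \forall m \near \oo, normc (l - u m) < e.
Proof.
move=> /cvgrPdist_lt H e e0; near=> m; rewrite -ltcR -normc_norm.
by near: m; apply: H; rewrite ltcR.
Unshelve. all: by end_near.
Qed.

(** Domination by a geometric series gives absolute convergence of the real and
    imaginary parts, whose absolute values are at most the modulus. *)
Lemma normc_dominated_cvg u (M r : R) : 0 <= r -> r < 1 ->
    (forall k, normc (u k) <= M * r ^+ k) ->
  exists2 l : R[i], ((fun m => \sum_(0 <= k < m) u k) : nat -> R[i]^o) @ \oo --> (l : R[i]^o)
    & normc l <= M / (1 - r).
Proof.
move=> r0 r1 uM.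
have M0 : 0 <= M by rewrite (le_trans (normc_ge0 (u 0%N)))// (le_trans (uM _))// expr0 mulr1.
have dom (f : nat -> R) : (forall k, `|f k| <= normc (u k)) -> cvgn (series f).
  move=> fu; apply: normed_cvg; apply: series_le_cvg (is_cvg_geometric_series (a := M) (z := r) _).
  - by move=> k; exact: normr_ge0.
  - by move=> k; rewrite /geometric /= mulr_ge0 ?exprn_ge0.
  - by move=> k; rewrite /geometric /= (le_trans (fu k)).
  - by rewrite ger0_norm.
have le_sum m : normc (\sum_(0 <= k < m) u k) <= \sum_(0 <= k < m) M * r ^+ k.
  elim: m => [|m IH]; first by rewrite !big_nil normc0.
  by rewrite !big_nat_recr//= (le_trans (le_normcD _ _))// lerD.
have /cvg_ex[x ux] := dom (@complex.Re R \o u) (fun k => le_Re_normc (u k)).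
have /cvg_ex[y uy] := dom (@complex.Im R \o u) (fun k => le_Im_normc (u k)).
have cv : ((fun m => \sum_(0 <= k < m) u k) : nat -> R[i]^o) @ \oo --> (Complex x y : R[i]^o).
  apply: complex_cvg_normc => e e0; near=> m.
  apply: le_lt_trans (le_normc_ReIm _) _; rewrite (splitr e).
  rewrite !raddfB/= !raddf_sum/= !sumrN ltrD//.
  - near: m; have /cvgrPdist_lt := ux; apply; exact: divr_gt0.
  - near: m; have /cvgrPdist_lt := uy; apply; exact: divr_gt0.
exists (Complex x y) => //; apply/ler_addgt0Pl => e e0.
have : \forall m \near \oo, normc (Complex x y) <= e + M / (1 - r).
  near=> m; rewrite -[X in normc X](subrK (\sum_(0 <= k < m) u k)).
  apply: le_trans (le_normcD _ _) _; apply: lerD.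
    by apply: ltW; near: m; exact: complex_cvgP.
  apply: le_trans (le_sum m) _.
  have := geometric_seriesE M (negbT (lt_eqF r1)); rewrite /series/geometric/=.
  move=> /(congr1 (fun f => f m))/= ->.
  by rewrite ler_wpM2r ?invr_ge0 ?subr_ge0 ?(ltW r1)// ler_piMr// gerBl exprn_ge0.
by case=> N _ /(_ N (leqnn N)).
Unshelve. all: by end_near.
Qed.

End ComplexConvergence.

Section Expansion.
Variables (R : realType) (N : nat) (D : {set 'I_N}) (b : R[i]).
Hypothesis b_gt1 : 1 < normc b.
Implicit Types a : digit_seq D.

Definition expansion_bound : R := N%:R / (normc b - 1).

Lemma expansion_bound_ge0 : 0 <= expansion_bound.
Proof. by rewrite divr_ge0// subr_ge0 ltW. Qed.

Lemma base_neq0 : b != 0.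
Proof. by apply: contraTneq b_gt1 => ->; rewrite normc0 -leNgt ler01. Qed.

Let b_gt0 : 0 < normc b := lt_trans ltr01 b_gt1.

Lemma expansion_cvg a :
  ((fun m => \sum_(0 <= k < m) (\val (a k))%:R * b ^- k.+1) : nat -> R[i]^o)
    @ \oo --> expansion b a
  /\ normc (expansion b a) <= expansion_bound.
Proof.
have r0 : 0 <= (normc b)^-1 by rewrite invr_ge0 ltW.
have r1 : (normc b)^-1 < 1 by rewrite invf_lt1.
have uM k : normc ((\val (a k))%:R * b ^- k.+1) <= N%:R / normc b * (normc b)^-1 ^+ k.
  rewrite normcM normcV normcX normc_natr -mulrA -exprS exprVn.
  by rewrite ler_wpM2r ?invr_ge0 ?exprn_ge0 ?(ltW b_gt0)// ler_nat ltnW.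
have [l cl lM] := normc_dominated_cvg r0 r1 uM.
have El : expansion b a = l by apply: cvg_lim => //; exact: norm_hausdorff.
rewrite El; split=> //; apply: le_trans lM _; rewrite le_eqVlt; apply/orP; left.
apply/eqP; rewrite /expansion_bound -mulrA -invfM mulrBr mulr1 mulfV ?gt_eqF//.
Qed.

Lemma normc_expansion a : normc (expansion b a) <= expansion_bound.
Proof. by case: (expansion_cvg a). Qed.

(** Together with the boundedness of expansions, this functional equation is all
    that is used about them: it determines the map. *)
Lemma expansion_step a :
  b * expansion b a = (\val (a 0%N))%:R + expansion b (shift a).
Proof.
have [ca _] := expansion_cvg a; have [cs _] := expansion_cvg (shift a).
have b0 := base_neq0.
apply: (mulfI (invr_neq0 b0)); rewrite mulKf//.
rewrite {1}/expansion; apply: (@cvg_lim R[i]^o); first exact: norm_hausdorff.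
rewrite -(cvg_shiftS _); apply: complex_cvg_normc => e e0; near=> m; rewrite /=.
have -> : \sum_(0 <= k < m.+1) (\val (a k))%:R * b ^- k.+1 =
    b^-1 * ((\val (a 0%N))%:R + \sum_(0 <= k < m) (\val (shift a k))%:R * b ^- k.+1).
  rewrite big_nat_recl// mulrDr expr1 mulrC; congr (_ + _); rewrite mulr_sumr.
  by apply: eq_bigr => k _; rewrite mulrCA -invfM -exprS.
rewrite -mulrBr opprD addrACA subrr add0r normcM normcV.
apply: (@le_lt_trans _ _ (normc (expansion b (shift a) -
    \sum_(0 <= k < m) (\val (shift a k))%:R * b ^- k.+1))).
  by rewrite ler_piMl ?normc_ge0// invf_le1// ltW.
by near: m; exact: complex_cvgP.
Unshelve. all: by end_near.
Qed.

End Expansion.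

(** * Gaussian integers with given digits *)

Section Words.
Variables (N : nat) (D : {set 'I_N}).
Implicit Types a : digit_seq D.

Lemma iter_shift a m k : iter m shift a k = a (m + k)%N.
Proof. by elim: m k => [|m IH] k //=; rewrite /Defs.shift IH addnS. Qed.

Definition word a m : m.-tuple (digit D) := [tuple a i | i < m].

Lemma wordP a a' m : word a m = word a' m <-> forall k, (k < m)%N -> a k = a' k.
Proof.
split=> [e k km|e]; last by apply: eq_from_tnth => i; rewrite !tnth_mktuple e.
by move/(congr1 (fun w => tnth w (Ordinal km))): e; rewrite !tnth_mktuple.
Qed.

End Words.

Section Lattice.
Variable n : nat.

(** Coordinates in the basis [(1, b)] of the value at [b] of the polynomial with
    coefficients [d 0, ..., d (m - 1)], leading one first: the next value is
    [b] times the previous one plus a digit, and [b ^ 2 = - 2 n b - (n ^ 2 + 1)].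
    The digits may be negative, so that differences of digit sequences are
    covered. *)
Fixpoint carry (d : nat -> int) (m : nat) : int * int :=
  if m is k.+1 then
    (d k - (n%:Z ^+ 2 + 1) * (carry d k).2, (carry d k).1 - 2 * n%:Z * (carry d k).2)
  else (0, 0).

Lemma carryB d d' m :
  carry (fun k => d k - d' k) m =
  ((carry d m).1 - (carry d' m).1, (carry d m).2 - (carry d' m).2).
Proof.
elim: m => [|m /= ->]/=; first by rewrite subrr.
by congr pair; ring.
Qed.

(** The digits form a system of residues modulo [n ^ 2 + 1], the norm of [b]: the
    first coordinate determines the last digit, and one proceeds backwards. *)
Lemma carry_inj d d' m :
    (forall k, 0 <= d k <= n%:Z ^+ 2) -> (forall k, 0 <= d' k <= n%:Z ^+ 2) ->
  carry d m = carry d' m -> forall k, (k < m)%N -> d k = d' k.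
Proof.
move=> dn dn'; elim: m => [//|m IH] /= [] e1 e2.
have := dn m; have := dn' m => h h'.
have ey : (carry d m).2 = (carry d' m).2.
  move: (carry d m).2 (carry d' m).2 (d m) (d' m) (n%:Z) e1 h h'; nia.
have ed : d m = d' m by move: e1; rewrite ey => /addIr.
have ex : (carry d m).1 = (carry d' m).1 by move: e2; rewrite ey => /addIr.
move=> k; rewrite ltnS leq_eqVlt => /predU1P[->//|]; apply: IH.
by move: ex ey; case: carry => ? ?; case: carry => ? ? /= -> ->.
Qed.

Variable R : realType.

Definition base : R[i] := Complex (- n%:R) 1.

Definition lattice_point (s : int * int) : R[i] := s.1%:~R + s.2%:~R * base.

Lemma lattice_pointB s s' :
  lattice_point (s.1 - s'.1, s.2 - s'.2) = lattice_point s - lattice_point s'.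
Proof. by rewrite /lattice_point /= !rmorphB/=; ring. Qed.

Lemma lattice_pointE s : lattice_point s = Complex (s.1%:~R - s.2%:~R * n%:R) s.2%:~R.
Proof.
rewrite /lattice_point /base -![_%:~R : R[i]](rmorph_int (real_complex R)).
by case: s => x y /=; apply/eqP; rewrite eq_complex /=; apply/andP; split; apply/eqP; ring.
Qed.

Lemma lattice_point_bound s (r : R) : normc (lattice_point s) <= r ->
  `|s.2|%:~R <= r /\ `|s.1|%:~R <= r * n.+1%:R.
Proof.
rewrite lattice_pointE => sr.
(* The second coordinate is the imaginary part. *)
have y_le : `|s.2%:~R : R| <= r by apply: le_trans (le_Im_normc _) sr.
have x_le := le_trans (le_Re_normc _) sr; rewrite /= in x_le.
rewrite !intr_norm; split=> //.
rewrite -(subrK (s.2%:~R * n%:R) s.1%:~R) -nat1r mulrDr mulr1.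
rewrite (le_trans (ler_normD _ _))// lerD// normrM (ger0_norm (ler0n _ n)).
exact: ler_wpM2r.
Qed.

End Lattice.

(** * Injectivity of the expansion and number of nearby words *)

Section Coding.
Variables (R : realType) (n : nat) (D : {set 'I_(n ^ 2).+1%N}).
Hypothesis n_ge2 : (2 <= n)%N.
Implicit Types a : digit_seq D.

Local Notation b := (base n R).
Local Notation pi := (expansion b : digit_seq D -> R[i]^o).

Lemma normc_base : normc b = Num.sqrt (n%:R ^+ 2 + 1).
Proof. by rewrite /= sqrrN expr1n. Qed.

Lemma base_gt1 : 1 < normc b.
Proof.
rewrite normc_base -[ltLHS]sqrtr1 ltr_sqrt ?addr_gt0 ?exprn_gt0 ?ltr0n ?(ltnW n_ge2)//.
by rewrite ltrDr exprn_gt0// ltr0n (ltnW n_ge2).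
Qed.

Definition digits a : nat -> int := fun k => (\val (a k) : nat)%:Z.

Lemma digits_itv a k : 0 <= digits a k <= n%:Z ^+ 2.
Proof. by rewrite /digits expr2 -PoszM mulnn !lez_nat/= -ltnS ltn_ord. Qed.

Lemma expansion_carry a m :
  b ^+ m * pi a = lattice_point n R (carry n (digits a) m) + pi (iter m shift a).
Proof.
elim: m => [|m IH]; first by rewrite expr0 mul1r /lattice_point/= !mul0r !add0r.
rewrite exprS -mulrA IH mulrDr (expansion_step base_gt1) iterS iter_shift addn0.
rewrite [in RHS]/lattice_point /= -/(lattice_point n R _) addrA; congr (_ + _).
have b2 : b ^+ 2 = - (2 * n%:R) * b - (n%:R ^+ 2 + 1).
  have nC : (n%:R : R[i]) = n%:R%:C%C by rewrite rmorph_nat.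
  by rewrite nC /base; apply/eqP; rewrite eq_complex /=; apply/andP; split; apply/eqP; ring.
rewrite /lattice_point mulrDr mulrCA -expr2 b2 /digits.
case: carry => x y /=; rewrite !(rmorphB, rmorphD, rmorphM, rmorphXn)/=.
by rewrite -!pmulrn; ring.
Qed.

Lemma expansion_inj (D_nonadjacent : forall d d' : 'I_(n ^ 2).+1%N,
    d \in D -> d' \in D -> `|(d : nat)%:Z - (d' : nat)%:Z| != 1) :
  injective pi.
Proof.
move=> a a' eq_pi; pose d k := digits a k - digits a' k.
pose C := expansion_bound (n ^ 2).+1 b.
have dn k : `|d k| <= n%:Z ^+ 2.
  by rewrite /d; have := digits_itv a k; have := digits_itv a' k; lia.
have d_neq1 k : `|d k| != 1 by apply: D_nonadjacent; exact: valP.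
(* The difference of the two Gaussian integers is also a difference of two
   expansions. *)
have yB k : (`|(carry n d k).2| <= Num.bound (C + C))%N.
  have : normc (lattice_point n R (carry n d k)) <= C + C.
    have -> : lattice_point n R (carry n d k) =
        pi (iter k shift a') - pi (iter k shift a).
      rewrite carryB lattice_pointB; apply/eqP.
      rewrite subr_eq addrAC eq_sym subr_eq [eqbLHS]addrC eq_sym.
      by rewrite -!expansion_carry eq_pi.
    apply: le_trans (le_normcD _ _) _; rewrite normcN.
    by apply: lerD; exact: (normc_expansion base_gt1).
  move=> /lattice_point_bound[yC _].
  have CC0 : 0 <= C + C by rewrite addr_ge0// (expansion_bound_ge0 _ base_gt1).
  rewrite -(ler_nat R) (le_trans _ (ltW (archi_boundP CC0)))//.
have carry0 m : carry n d m = (0, 0).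
  elim: m => [//|m IH] /=; rewrite IH /= !mulr0 !subr0; congr pair.
  have := @recurrence_after_zeros n (fun m => (carry n d m).2) _ n_ge2 yB _ m.
  rewrite /= !IH/= !mulr0 !subr0 => /(_ _ erefl erefl) d_le1.
  have := d_neq1 m; suff : `|d m| <= 1 by lia.
  apply: d_le1 => k; rewrite (_ : _ + _ = d k)//=; ring.
apply/funext => k; do 2! apply: val_inj; have := carry0 k.+1.
by rewrite /= carry0/= !mulr0 !subr0 => -[] /eqP; rewrite subr_eq0 => /eqP[].
Qed.

Lemma expansion_cylinder a a' m : word a m = word a' m ->
  normc (pi a - pi a') <= 2 * expansion_bound (n ^ 2).+1 b / normc b ^+ m.
Proof.
move=> /wordP e; have b0 : 0 < normc b := lt_trans ltr01 base_gt1.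
have ec : carry n (digits a) m = carry n (digits a') m.
  elim: m e => [//|m IH] e /=; rewrite IH => [|k km]; last by rewrite e// ltnW.
  by rewrite /digits e.
rewrite ler_pdivlMr ?exprn_gt0// mulrC -normcX -normcM mulrBr !expansion_carry ec.
rewrite opprD addrACA subrr add0r (le_trans (le_normcD _ _))// normcN mulr_natl mulr2n.
by apply: lerD; exact: (normc_expansion base_gt1).
Qed.

(** After multiplication by [b ^ m], the points [pi (f w)] are at distance at most
    [1] from each other, so the Gaussian integers of the words [w] have bounded
    differences; they are pairwise distinct by [carry_inj]. *)
Lemma card_words_near : exists2 K : nat, (0 < K)%N &
  forall m (S : {set m.-tuple (digit D)}) (f : m.-tuple (digit D) -> digit_seq D),
    (forall w, w \in S -> word (f w) m = w) ->
    (forall w w', w \in S -> w' \in S -> normc (pi (f w) - pi (f w')) <= (normc b ^+ m)^-1) ->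
  (#|S| <= K)%N.
Proof.
pose C := expansion_bound (n ^ 2).+1 b.
pose B := Num.bound ((1 + (C + C)) * n.+1%:R).
have b0 : 0 < normc b := lt_trans ltr01 base_gt1.
have C0 : 0 <= C := expansion_bound_ge0 (n ^ 2).+1 base_gt1.
exists ((B.*2).+1 * (B.*2).+1)%N => // m S f fS near.
have [->|[w0 w0S]] := set_0Vmem S; first by rewrite cards0.
pose s w := carry n (digits (f w)) m.
have sB w : w \in S -> (`|(s w).1 - (s w0).1| <= B)%N /\ (`|(s w).2 - (s w0).2| <= B)%N.
  move=> wS.
  have /lattice_point_bound[yC xC] : normc (lattice_point n R
      ((s w).1 - (s w0).1, (s w).2 - (s w0).2)) <= 1 + (C + C).
    have -> : lattice_point n R ((s w).1 - (s w0).1, (s w).2 - (s w0).2) =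
        b ^+ m * (pi (f w) - pi (f w0)) +
        (pi (iter m shift (f w0)) - pi (iter m shift (f w))).
      rewrite mulrBr !expansion_carry -/(s w) -/(s w0).
      by rewrite lattice_pointB; ring.
    apply: le_trans (le_normcD _ _) _; apply: lerD.
      by rewrite normcM normcX -ler_pdivlMl ?exprn_gt0// mulr1 near.
    apply: le_trans (le_normcD _ _) _; rewrite normcN.
    by apply: lerD; exact: (normc_expansion base_gt1).
  rewrite -!(ler_nat R).
  have C1 : 0 <= (1 + (C + C)) * n.+1%:R by rewrite mulr_ge0// !addr_ge0.
  split; rewrite (le_trans _ (ltW (archi_boundP C1)))// (le_trans yC)//.
  by rewrite ler_peMr ?addr_ge0// ler1n.
(* Coordinates relative to [w0], translated by [B] to be natural numbers. *)
pose g w : 'I_(B.*2).+1 * 'I_(B.*2).+1 :=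
  (inord `|((s w).1 - (s w0).1 + B%:Z)%R|%N, inord `|((s w).2 - (s w0).2 + B%:Z)%R|%N).
have g_inj : {in S &, injective g}.
  move=> w w' wS w'S [/(congr1 val) /= e1 /(congr1 val) /= e2].
  have [x1 y1] := sB _ wS; have [x2 y2] := sB _ w'S.
  rewrite !inordK in e1 e2; try lia.
  rewrite -(fS _ wS) -(fS _ w'S); apply/wordP => k km; do 2! apply: val_inj.
  suff ss : s w = s w'.
    by case: (carry_inj (digits_itv (f w)) (digits_itv (f w')) ss km).
  by move: e1 e2 x1 x2 y1 y2; case: (s w) => ? ?; case: (s w') => ? ? /= *; congr pair; lia.
rewrite -(card_in_imset g_inj) (leq_trans (max_card _))//.
by rewrite card_prod !card_ord.
Qed.

End Coding.

(** * Subshifts and their languages *)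

Section SequenceSpace.
Variables (N : nat) (D : {set 'I_N}).
Implicit Types (A : set (digit_seq D)) (a : digit_seq D).

Lemma digit_seq_compact : compact [set: digit_seq D].
Proof.
have fD : finite_set [set: digit D] by exact: finite_finset.
have := @tychonoff nat (fun=> discrete_topology (digit D)) (fun=> setT)
  (fun=> @finite_compact (discrete_topology (digit D)) _ fD).
by rewrite (_ : [set f | _] = setT)//; apply/seteqP.
Qed.

Lemma closed_digit_seq_compact A : closed A -> compact A.
Proof. by move=> cA; apply: subclosed_compact cA digit_seq_compact _. Qed.

Lemma cylinder_nbhs a m : \forall a' \near a, word a' m = word a m.
Proof.
suff: \forall a' \near a, forall k, (k < m)%N -> a' k = a k.
  by apply: filterS => a' /wordP.
elim: m => [|m IH]; first exact: filterE.
have nm : \forall a' \near a, a' m = a m.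
  have := @proj_continuous nat (fun=> discrete_topology (digit D)) m a [set a m].
  by apply; exact: discrete_set1.
near=> a' => k; rewrite ltnS leq_eqVlt => /predU1P[->|]; first by near: a'.
by move: k; near: a'.
Unshelve. all: by end_near.
Qed.

(** The numbers [k0] that are large enough form a neighborhood of infinity, to
    which compactness applies in its near-covering form. *)
Lemma compact_nat_cover (T : topologicalType) (A : set T) (O : nat -> set T) :
  compact A -> (forall k, open (O k)) -> A `<=` \bigcup_k O k ->
  exists k0, forall x, A x -> exists2 k, (k < k0)%N & O k x.
Proof.
move=> /compact_near_coveringP cA oO AO.
have /cA : forall x, A x -> \forall x' \near x & i \near \oo,
    (fun i x => exists2 k, (k < i)%N & O k x) i x'.
  move=> x /AO[k _ Okx]; exists (O k, [set i | (k < i)%N]) => /=.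
    by split; [exact: open_nbhs_nbhs|exists k.+1].
  by move=> [x' i] [/= Ox' ki]; exists k.
by case=> k0 _ /(_ k0 (leqnn k0)); exists k0.
Qed.

Lemma languageP A m (w : m.-tuple (digit D)) :
  reflect (exists2 a, A a & word a m = w) (w \in language A m).
Proof.
rewrite inE; apply: (iffP (asboolP _)) => -[a Aa aw]; exists a => //.
  by apply: eq_from_tnth => i; rewrite tnth_mktuple aw.
by move=> i; rewrite -aw tnth_mktuple.
Qed.

Lemma word_language A m a : A a -> word a m \in language A m.
Proof. by move=> Aa; apply/languageP; exists a. Qed.

Lemma language_gt0 A m : A !=set0 -> (0 < #|language A m|)%N.
Proof. by case=> a Aa; apply/card_gt0P; exists (word a m); exact: word_language. Qed.

Lemma subshift_iter A m a : subshift A -> A a -> A (iter m shift a).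
Proof. by move=> [_ sA] Aa; elim: m => //= m IH; apply: sA; exists (iter m shift a). Qed.

Lemma word_cat a a' k m : word a k = word a' k ->
  word (iter k shift a) m = word (iter k shift a') m ->
  word a (k + m) = word a' (k + m).
Proof.
move=> /wordP e1 /wordP e2; apply/wordP => i ikm.
have [/e1//|ki] := ltnP i k.
have := e2 (i - k)%N; rewrite !iter_shift subnKC//; apply.
by rewrite ltn_subLR.
Qed.

(** A word of length [k + m] of a subshift is determined by its first [k] letters
    and its last [m] ones, and the latter form a word of the language by shift
    invariance. *)
Lemma card_split_le A M k m (S : {set k.-tuple (digit D)})
    (T : {set M.-tuple (digit D)}) :
  subshift A -> M = (k + m)%N ->
  (forall w, w \in T -> exists a, [/\ A a, word a M = w & word a k \in S]) ->
  (#|T| <= #|S| * #|language A m|)%N.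
Proof.
move=> sA eM TP; subst M; have [->|[w0 w0T]] := set_0Vmem T; first by rewrite cards0.
have [a0 _] := TP _ w0T.
have /choice[f /= fP] : forall w : (k + m).-tuple (digit D), exists a,
    w \in T -> [/\ A a, word a (k + m) = w & word a k \in S].
  by move=> w; have [/TP[a aP]|wT] := boolP (w \in T); [exists a|exists a0].
pose g w := (word (f w) k, word (iter k shift (f w)) m).
have g_inj : {in T &, injective g}.
  move=> w w' /fP[_ fw _] /fP[_ fw' _] e.
  by rewrite -fw -fw'; apply: word_cat; [move/(congr1 fst): e|move/(congr1 snd): e].
rewrite -cardsX -(card_in_imset g_inj); apply: subset_leq_card.
apply/fintype.subsetP => _ /imsetP[w /fP[Afw _ Sfw] ->]; rewrite inE/= Sfw/=.
by apply: word_language; exact: subshift_iter.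
Qed.

Lemma card_language_submul A k m : subshift A ->
  (#|language A (k + m)| <= #|language A k| * #|language A m|)%N.
Proof.
move=> sA; apply: card_split_le => // w /languageP[a Aa aw].
by exists a; split=> //; exact: word_language.
Qed.

Lemma card_cover_le (T I : finType) (S : {set T}) (F : I -> {set T}) (P : pred I) :
  (forall x, x \in S -> exists2 i, P i & x \in F i) -> (#|S| <= \sum_(i | P i) #|F i|)%N.
Proof.
move=> SF; apply: (@leq_trans #|\bigcup_(i | P i) F i|).
  by apply/subset_leq_card/fintype.subsetP => x /SF[i Pi xi]; apply/bigcupP; exists i.
apply: (big_ind2 (fun (B : {set T}) c => (#|B| <= c)%N)) => //; first by rewrite cards0.
by move=> B1 c1 B2 c2 h1 h2; rewrite (leq_trans (leq_card_setU _ _))// leq_add.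
Qed.

End SequenceSpace.

(** * Subshifts and invariant sets *)

Section ExpansionTopology.
Variables (R : realType) (n : nat) (D : {set 'I_(n ^ 2).+1%N}).
Hypothesis n_ge2 : (2 <= n)%N.

Local Notation b := (base n R).
Local Notation pi := (expansion b : digit_seq D -> R[i]^o).

Lemma expansion_continuous : continuous pi.
Proof.
move=> a; apply: (@complex_cvg_normc R _ (nbhs a) _ (expansion b) (expansion b a)) => e e0.
have b1 := base_gt1 R n_ge2; have b0 := lt_trans ltr01 b1.
have C0 : 0 <= 2 * expansion_bound (n ^ 2).+1 b by rewrite mulr_ge0 ?expansion_bound_ge0.
have [m mC] : exists m, 2 * expansion_bound (n ^ 2).+1 b / normc b ^+ m < e.
  have : (fun m => 2 * expansion_bound (n ^ 2).+1 b * (normc b)^-1 ^+ m) @ \oo --> (0 : R).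
    by apply: cvg_geometric; rewrite ger0_norm ?invf_lt1 ?invr_ge0 ?(ltW b0).
  move=> /cvgrPdist_lt /(_ _ e0)[m _ /(_ m (leqnn m))].
  have r0 : 0 <= (normc b)^-1 ^+ m by rewrite exprn_ge0// invr_ge0 ltW.
  by rewrite sub0r normrN (ger0_norm (mulr_ge0 C0 r0)) exprVn; exists m.
have := cylinder_nbhs a m; apply: filterS => a' /esym aa'.
exact: (le_lt_trans (expansion_cylinder R n_ge2 aa') mC).
Qed.

Hypothesis D_nonadjacent : forall d d' : 'I_(n ^ 2).+1%N,
  d \in D -> d' \in D -> `|(d : nat)%:Z - (d' : nat)%:Z| != 1.

Lemma subshift_times_invariant (A : set (digit_seq D)) :
  A !=set0 -> subshift A -> times_invariant D b (expansion b @` A).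
Proof.
move=> [a Aa] [cA sA]; split.
- by exists (pi a); exists a.
- apply: compact_closed; first exact: norm_hausdorff.
  apply: continuous_compact; last exact: closed_digit_seq_compact.
  exact/continuous_subspaceT/expansion_continuous.
- by move=> _ [x _ <-]; exists x.
- move=> z [x Ax xz]; rewrite /expansion_shift /=.
  have -> : decoding z = x.
    apply: (expansion_inj n_ge2 D_nonadjacent (R := R)); rewrite xz.
    by have /(congr1 val) := decodingK z.
  by exists (shift x) => //; apply: sA; exists x.
Qed.

(** The subshift is the preimage of [Y]: it is closed by continuity, and shift
    invariant since, by injectivity, [decoding] undoes [coding]. *)
Lemma times_invariant_subshift (Y : set R[i]^o) : times_invariant D b Y ->
  exists A : set (digit_seq D), [/\ A !=set0, subshift A & Y = expansion b @` A].
Proof.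
move=> [[y Yy] cY Ysub YT]; exists (expansion b @^-1` Y); split.
- by have [a _ ay] := Ysub _ Yy; exists a; rewrite /= ay.
- split.
    by apply: closed_comp cY => a _; exact: expansion_continuous.
  move=> _ [a /= Ya <-]; have := YT (coding b a) Ya.
  rewrite /expansion_shift /=; congr (Y (expansion b (shift _))).
  apply: (expansion_inj n_ge2 D_nonadjacent (R := R)).
  by have /(congr1 val) := decodingK (coding b a).
- apply/seteqP; split=> [z Yz|_ [a Ya <-]//].
  by have [a _ az] := Ysub _ Yz; exists a; rewrite /= ?az.
Qed.

End ExpansionTopology.

(** * Box dimension *)

Section Diameter.
Variable R : realType.
Implicit Types U : set R[i]^o.

Lemma diam_le U (r : R) : 0 <= r ->
  (forall x y, U x -> U y -> normc (x - y) <= r) -> (diam U <= r%:E)%E.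
Proof.
move=> r0 Ur; rewrite /diam ge_max lee_fin r0/=.
by apply: ge_ereal_sup => _ [x Ux [y Uy <-]]; rewrite lee_fin Ur.
Qed.

Lemma le_diam U x y : U x -> U y -> ((normc (x - y))%:E <= diam U)%E.
Proof.
move=> Ux Uy; rewrite /diam le_max; apply/orP; right.
by apply: ereal_sup_ubound; exists x => //; exists y.
Qed.

Lemma diam_ge0 U : (0 <= diam U)%E.
Proof. by rewrite /diam le_max lexx. Qed.

End Diameter.

Section LanguageGrowth.
Variables (R : realType) (N : nat) (D : {set 'I_N}) (A : set (digit_seq D)).
Hypotheses (A_neq0 : A !=set0) (A_subshift : subshift A).

Definition log_language m : R := ln (#|language A m|%:R).

Lemma log_language_ge0 m : 0 <= log_language m.
Proof. by apply: ln_ge0; rewrite ler1n language_gt0. Qed.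

Lemma log_language_subadd k m :
  log_language (k + m) <= log_language k + log_language m.
Proof.
have L0 j : 0 < #|language A j|%:R :> R by rewrite ltr0n language_gt0.
rewrite -lnM ?posrE// ler_ln ?posrE ?mulr_gt0// -natrM ler_nat.
exact: card_language_submul.
Qed.

Lemma entropy_cvg : (fun m => log_language m / m%:R) @ \oo --> entropy R A.
Proof. exact: subadditive_cvg log_language_ge0 log_language_subadd. Qed.

Lemma entropy_ge0 : 0 <= entropy R A.
Proof.
apply: limr_ge; first exact: subadditive_cvg log_language_ge0 log_language_subadd.
by apply: nearW => m; rewrite divr_ge0// log_language_ge0.
Qed.

End LanguageGrowth.

Section BoxDimension.
Variables (R : realType) (n : nat) (D : {set 'I_(n ^ 2).+1%N}).
Hypothesis n_ge2 : (2 <= n)%N.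

Local Notation b := (base n R).
Local Notation pi := (expansion b : digit_seq D -> R[i]^o).

Variable A : set (digit_seq D).
Hypotheses (A_neq0 : A !=set0) (A_subshift : subshift A).

Let b1 : 1 < normc b := base_gt1 R n_ge2.
Let b0 : 0 < normc b := lt_trans ltr01 b1.
Let C : R := 2 * expansion_bound (n ^ 2).+1 b.
Let C0 : 0 <= C.
Proof. by rewrite mulr_ge0// (expansion_bound_ge0 _ b1). Qed.

Definition cylinder_image m (w : m.-tuple (digit D)) : set R[i]^o :=
  [set pi a | a in [set a | A a /\ word a m = w]].

Lemma diam_cylinder_image m (w : m.-tuple (digit D)) :
  (diam (cylinder_image w) <= (C / normc b ^+ m)%:E)%E.
Proof.
apply: diam_le; first by rewrite divr_ge0// exprn_ge0// ltW.
move=> _ _ [a [_ aw] <-] [a' [_ aw'] <-].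
by apply: expansion_cylinder => //; rewrite aw aw'.
Qed.

Lemma covering_number_le m (delta : R) : C / normc b ^+ m <= delta ->
  (covering_number (expansion b @` A) delta <= #|language A m|%:R%:E)%E.
Proof.
move=> Cd; apply: ereal_inf_lbound; exists #|language A m| => //.
exists (fun i => cylinder_image (enum_val i)); split.
  move=> _ [a Aa <-]; have wL := word_language m Aa.
  by exists (enum_rank_in wL (word a m)) => //; exists a; rewrite ?enum_rankK_in.
by move=> i; apply: le_trans (diam_cylinder_image _) _; rewrite lee_fin.
Qed.

(** The points of [U] lying in distinct cylinders satisfy the hypothesis of
    [card_words_near].  This complements [diam_cylinder_image]: cylinders are not
    only small, but also spread out. *)
Lemma card_words_meeting : exists2 K : nat, (0 < K)%N &
  forall m (U : set R[i]^o), (diam U <= ((normc b ^+ m)^-1)%:E)%E ->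
  forall S : {set m.-tuple (digit D)},
    (forall w, w \in S -> exists a, [/\ A a, word a m = w & U (pi a)]) ->
  (#|S| <= K)%N.
Proof.
have [K K0 HK] := @card_words_near R n D n_ge2; exists K => // m U dU S SP.
have [a0 Aa0] := A_neq0.
have /choice[f /= fP] : forall w : m.-tuple (digit D), exists a,
    w \in S -> [/\ A a, word a m = w & U (pi a)].
  by move=> w; have [/SP[a aP]|wS] := boolP (w \in S); [exists a|exists a0].
apply: (HK m S f) => [w /fP[]//|w w' /fP[_ _ Uw] /fP[_ _ Uw']].
by rewrite -lee_fin (le_trans _ dU)// le_diam.
Qed.

Lemma le_covering_number : exists2 K : nat, (0 < K)%N &
  forall m (delta : R), delta <= (normc b ^+ m)^-1 ->
  ((#|language A m|%:R / K%:R)%:E <= covering_number (expansion b @` A) delta)%E.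
Proof.
have [K K0 HK] := card_words_meeting; exists K => // m delta dm.
apply: le_ereal_inf_tmp => _ [p [U [AU dU]] <-].
rewrite lee_fin ler_pdivrMr ?ltr0n// -natrM ler_nat.
pose F (i : 'I_p) := [set w in language A m | `[< exists a, [/\ A a, word a m = w & U i (pi a)] >]].
have FK i : (#|F i| <= K)%N.
  apply: (HK m (U i)) => [|w]; first by apply: le_trans (dU i) _; rewrite lee_fin.
  by rewrite inE => /andP[_ /asboolP].
apply: leq_trans (_ : \sum_(i < p) #|F i| <= _)%N.
  apply: card_cover_le => w wL; have /languageP[a Aa aw] := wL.
  have [|i _ Ui] := AU (pi a); first by exists a.
  by exists i => //; rewrite inE wL; apply/asboolP; exists a.
apply: (@leq_trans (\sum_(i < p) K)); first by apply: leq_sum => i _.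
by rewrite sum_nat_const card_ord.
Qed.

Local Notation lam := (ln (normc b)).

Lemma lam_gt0 : 0 < lam. Proof. exact: ln_gt0. Qed.

(** The level [m] with [|b| ^ - (m + 1) < delta <= |b| ^ - m] is compared with
    [delta]: a lower bound comes from the words of length [m], an upper bound from
    those of length [m + p], where [p] absorbs the constant in the diameter of
    cylinders and costs a bounded factor by submultiplicativity. *)
Lemma log_covering_number : exists2 kappa : R, 0 <= kappa &
  forall delta, 0 < delta -> delta < 1 -> exists r m,
   [/\ lne (covering_number (expansion b @` A) delta) = r%:E,
       `|r - log_language R A m| <= kappa,
       m%:R * lam <= - ln delta & - ln delta < m.+1%:R * lam].
Proof.
have [K K0 HK] := le_covering_number.
have [p Cp] : exists p, C / normc b ^+ p <= (normc b)^-1.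
  have : (fun m => C * (normc b)^-1 ^+ m) @ \oo --> (0 : R).
    by apply: cvg_geometric; rewrite ger0_norm ?invf_lt1 ?invr_ge0 ?(ltW b0).
  have ib0 : 0 < (normc b)^-1 by rewrite invr_gt0.
  move=> /cvgrPdist_lt /(_ _ ib0)[m _ /(_ m (leqnn m))].
  have r0 : 0 <= (normc b)^-1 ^+ m by rewrite exprn_ge0// ltW.
  by rewrite sub0r normrN (ger0_norm (mulr_ge0 C0 r0)) exprVn => /ltW; exists m.
have lnK0 : 0 <= ln (K%:R : R) by rewrite ln_ge0// ler1n.
exists (ln K%:R + log_language R A p); first by rewrite addr_ge0// log_language_ge0.
move=> delta d0 d1; pose m := Num.truncn (- ln delta / lam).
have ld0 : 0 <= - ln delta by rewrite oppr_ge0 ln_le0// ltW.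
have /truncn_itv/andP[] : 0 <= - ln delta / lam by rewrite divr_ge0// ltW// lam_gt0.
rewrite -/m ler_pdivlMr ?lam_gt0// ltr_pdivrMr ?lam_gt0// => m1 m2.
have dm : delta <= (normc b ^+ m)^-1.
  rewrite -ler_ln ?posrE ?invr_gt0 ?exprn_gt0// lnV ?posrE ?exprn_gt0// lnXn//.
  by rewrite lerNr -mulr_natl.
have dm' : C / normc b ^+ (p + m) <= delta.
  rewrite exprD invfM mulrA.
  apply: (@le_trans _ _ ((normc b)^-1 / normc b ^+ m)).
    by rewrite ler_wpM2r// invr_ge0 exprn_ge0// ltW.
  rewrite -invfM -exprS -ler_ln ?posrE ?invr_gt0 ?exprn_gt0// lnV ?posrE ?exprn_gt0// lnXn//.
  by rewrite lerNl -mulr_natl ltW.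
have low := HK _ _ dm; have up := covering_number_le dm'.
have L0 j : 0 < #|language A j|%:R :> R by rewrite ltr0n language_gt0.
have K0' : 0 < K%:R :> R by rewrite ltr0n.
move: low up; case: covering_number => [x||]//; rewrite !lee_fin => low up.
have x0 : 0 < x by apply: lt_le_trans low; rewrite divr_gt0.
exists (ln x), m; split=> //; first by rewrite lne_EFin.
rewrite -ler_ln ?posrE ?divr_gt0// ln_div ?posrE// -/(log_language R A m) in low.
rewrite -ler_ln ?posrE// -/(log_language R A _) in up.
have := log_language_subadd R A_neq0 A_subshift p m.
have := log_language_ge0 R A_neq0 p.
move: lnK0 low up; rewrite ler_norml.
move: (ln x) (ln K%:R) (log_language R A (p + m)) (log_language R A p) (log_language R A m).
by clear=> *; lra.
Qed.

Lemma box_ratio_cvg :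
  box_ratio (expansion b @` A) delta @[delta --> 0^'+] -->
  (entropy R A / lam)%:E.
Proof.
have [k k0 Hk] := log_covering_number; set h := entropy R A.
have lam0 := lam_gt0.
pose Good delta := exists r m,
  [/\ box_ratio (expansion b @` A) delta = (r / - ln delta)%:E,
      `|r - log_language R A m| <= k,
      m%:R * lam <= - ln delta & - ln delta < m.+1%:R * lam].
have good : \forall delta \near 0^'+, Good delta.
  near=> delta.
  have d0 : 0 < delta by near: delta; exact: nbhs_right_gt.
  have d1 : delta < 1 by near: delta; exact: nbhs_right_lt.
  have [r [m [Er rm m1 m2]]] := Hk _ d0 d1; exists r, m; split=> //.
  have l0 : - ln delta != 0 by rewrite gt_eqF// oppr_gt0 ln_lt0// d0.
  by rewrite /box_ratio Er inver (negbTE l0).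
apply/fine_cvgP; split; first by apply: filterS good => delta [r [m [-> _ _ _]]].
apply/cvgrPdist_le => e e0.
have e1 : 0 < e * lam / 2 by rewrite divr_gt0 ?mulr_gt0.
have [M _ HM] := cvg_ratioP (@entropy_cvg R _ _ _ A_neq0 A_subshift) e1.
(* Once [- ln delta] exceeds [l0], the level [m] is at least [M] and the bounded
   error [k + `|h|] is at most half of the allowed one. *)
pose l0 := Num.max (M.+1%:R * lam) (2 * (k + `|h|) / e).
have l00 : 0 < l0 by rewrite lt_max mulr_gt0.
near=> delta.
rewrite /=; have [r [m [-> rm m1 m2]]] : Good delta by near: delta.
have d0 : 0 < delta by near: delta; exact: nbhs_right_gt.
have : l0 <= - ln delta.
  rewrite lerNr -ler_expR lnK ?posrE//.
  by near: delta; apply: nbhs_right_ltW; exact: expR_gt0.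
rewrite ge_max => /andP[lM lk].
move: (- ln delta) m1 m2 lM lk => l m1 m2 lM lk.
have ll0 : 0 < l by apply: lt_le_trans lM; rewrite mulr_gt0.
have Mm : (M <= m)%N.
  rewrite -ltnS -(ltr_nat R) -(ltr_pM2r lam0) (le_lt_trans _ m2)//.
  by apply: le_trans lM; rewrite ler_wpM2r ?ltW// ltr_nat.
have {HM}Hm := HM _ Mm; rewrite -/h in Hm.
rewrite /= -(ler_pM2r ll0).
have -> : `|h / lam - r / l| * l = `|h / lam * l - r|.
  by rewrite -{2}(gtr0_norm ll0) -normrM mulrBl mulfVK ?gt_eqF.
have ml : `|h / lam * l - m%:R * h| <= `|h|.
  have -> : h / lam * l - m%:R * h = h * ((l - m%:R * lam) / lam).
    by field; rewrite gt_eqF.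
  rewrite normrM ler_piMr// ger0_norm ?divr_ge0 ?subr_ge0 ?(ltW lam0)//.
  rewrite ler_pdivrMr// mul1r lerBlDr -[X in X + _]mul1r -mulrDl nat1r ltW//.
have -> : h / lam * l - r = (h / lam * l - m%:R * h) - (log_language R A m - m%:R * h)
    - (r - log_language R A m) by ring.
apply: le_trans (ler_normB _ _) _; apply: le_trans (lerD (ler_normB _ _) (lexx _)) _.
have h1 : e * lam / 2 * m%:R <= e / 2 * l.
  have -> : e * lam / 2 * m%:R = e / 2 * (m%:R * lam) by ring.
  by rewrite ler_wpM2l// divr_ge0// ltW.
have h2 : k + `|h| <= e / 2 * l.
  by rewrite mulrAC ler_pdivlMr// (mulrC _ 2) (mulrC e) -ler_pdivrMr.
have -> : e * l = e / 2 * l + e / 2 * l by field.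
move: rm ml Hm h1 h2; move: (`|_|) (`|_|) (`|_|) (`|_|) (e / 2 * l) (_ * m%:R).
by clear=> *; lra.
Unshelve. all: by end_near.
Qed.

Lemma box_dim_expansion :
  box_dim_exists (expansion b @` A) /\
  box_dim (expansion b @` A) = (entropy R A / lam)%:E.
Proof.
split; first by apply/cvg_ex; eexists; exact: box_ratio_cvg.
by apply: cvg_lim => //; exact: box_ratio_cvg.
Qed.

End BoxDimension.

(** * Hausdorff dimension *)

(** Strong induction: if [L] is at most [B * rho ^ j] at all [j < M], the recursive
    inequality bounds [L M] by [B * rho ^ M] times [sum_i K / rho ^ l i <= 1].  The
    constant [B] takes care of the indices below [M0]. *)
Lemma renewal_bound (R : realType) (L : nat -> R) (K rho : R) (I : finType)
    (P : pred I) (l : I -> nat) (M0 : nat) :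
  0 <= K -> 0 < rho -> (forall i, P i -> (0 < l i <= M0)%N) ->
  (forall j, 0 <= L j) ->
  \sum_(i | P i) K / rho ^+ l i <= 1 ->
  (forall M, (M0 <= M)%N -> L M <= \sum_(i | P i) K * L (M - l i)%N) ->
  exists2 B, 0 < B & forall M, L M <= B * rho ^+ M.
Proof.
move=> K0 rho0 lP L0 sum1 LM.
pose B := 1 + \sum_(j < M0) L j / rho ^+ j.
have B0 : 0 < B.
  by rewrite ltr_wpDr// sumr_ge0// => j _; rewrite divr_ge0// exprn_ge0// ltW.
exists B => // M; elim/ltn_ind: M => M IH; have [MM0|M0M] := ltnP M M0.
  rewrite -ler_pdivrMr ?exprn_gt0// /B (bigD1 (Ordinal MM0))//= addrCA lerDl.
  by rewrite addr_ge0// sumr_ge0// => j _; rewrite divr_ge0// exprn_ge0// ltW.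
apply: le_trans (LM _ M0M) _.
apply: (@le_trans _ _ (\sum_(i | P i) (B * rho ^+ M) * (K / rho ^+ l i))).
  apply: ler_sum => i /lP/andP[l0 lM0].
  have lM : (l i <= M)%N := leq_trans lM0 M0M.
  rewrite mulrCA ler_wpM2l// -mulrA -expfB_cond ?gt_eqF//.
  by apply: IH; rewrite ltn_subrL l0 (leq_trans l0).
by rewrite -mulr_sumr ler_piMr// mulr_ge0 ?ltW ?exprn_gt0.
Qed.

(** The growth rate of [L] cannot be [h] if [L] is at most [B + M * g] with
    [g < h]: the length [M] is taken so large that half of the gap already
    exceeds [B]. *)
Lemma growth_contradiction (F : realFieldType) (B L h g M : F) :
  - ((h - g) / 2 * M) <= L - M * h -> B < (h - g) / 2 * M -> L <= B + M * g -> False.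
Proof. nra. Qed.

(** The logarithm of the [s]-sum over the cylinders of length [M], whose diameters
    have logarithm [lC - M * lam], is below [le] once half of the gap
    [s * lam - h] outweighs the constants. *)
Lemma growth_exponent (F : realFieldType) (s lC le L h lam M : F) :
  L - M * h <= (s * lam - h) / 2 * M -> s * lC - le <= M * ((s * lam - h) / 2) ->
  L + s * (lC - M * lam) <= le.
Proof. nra. Qed.

Lemma sum_half_le1 (R : realType) j : \sum_(k < j) (2^-1 : R) ^+ k.+1 <= 1.
Proof.
suff -> : \sum_(k < j) (2^-1 : R) ^+ k.+1 = 1 - 2^-1 ^+ j.
  by rewrite gerBl exprn_ge0// invr_ge0.
elim: j => [|j IH]; first by rewrite big_ord0 expr0 subrr.
by rewrite big_ord_recr/= IH exprS; field.
Qed.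

Lemma sum_prefix_le (R : realType) (x : R) j L : 0 <= x ->
  \sum_(0 <= k < j) (if (k < L)%N then x else 0) <= L%:R * x.
Proof.
move=> x0; have -> : \sum_(0 <= k < j) (if (k < L)%N then x else 0) = (minn j L)%:R * x.
  elim: j => [|j IH]; first by rewrite big_nil min0n mul0r.
  rewrite big_nat_recr//= IH; case: ltnP => jL.
    by rewrite (minn_idPl jL) -natr1 mulrDl mul1r.
  by rewrite (minn_idPr (leqW jL)) addr0.
by rewrite ler_wpM2r// ler_nat geq_minr.
Qed.

Section HausdorffDimension.
Variables (R : realType) (n : nat) (D : {set 'I_(n ^ 2).+1%N}).
Hypothesis n_ge2 : (2 <= n)%N.

Local Notation b := (base n R).
Local Notation pi := (expansion b : digit_seq D -> R[i]^o).
Local Notation lam := (ln (normc b)).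

Variable A : set (digit_seq D).
Hypotheses (A_neq0 : A !=set0) (A_subshift : subshift A).

Let b1 : 1 < normc b := base_gt1 R n_ge2.
Let b0 : 0 < normc b := lt_trans ltr01 b1.
Let lam0 : 0 < lam := lam_gt0 R n_ge2.

(** For [t > 0] the level is the one with [|b| ^ - (m + 1) < t <= |b| ^ - m].  A set
    of diameter [t = 0] has no natural level: if [s > 0], any large one makes the
    cost less than [e], and if [s = 0], the set has cost [0 `^ 0 = 1], which level
    [0] matches. *)
Lemma level_of_diameter (s t e : R) : 0 <= s -> 0 <= t -> t <= 1 -> 0 < e ->
  exists m, t <= (normc b ^+ m)^-1 /\
    ((normc b `^ s) ^+ m)^-1 <= normc b `^ s * t `^ s + e.
Proof.
move=> s0; rewrite le_eqVlt => /predU1P[<- _|t0 t1] e0.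
  move: s0; rewrite le_eqVlt => /predU1P[<-|s0].
    by exists 0%N; rewrite !expr0 invr1 !powRr0 mulr1; split=> //; rewrite lerDl ltW.
  have p1 : 1 < normc b `^ s.
    have := @gt0_ltr_powR R s s0 1 (normc b); rewrite powR1.
    by apply=> //; rewrite ?nnegrE ?ler01 ?(ltW b0).
  have p0 := lt_trans ltr01 p1.
  have : (fun m => 1 * (normc b `^ s)^-1 ^+ m) @ \oo --> (0 : R).
    by apply: cvg_geometric; rewrite ger0_norm ?invf_lt1 ?invr_ge0 ?(ltW p0).
  move=> /cvgrPdist_lt /(_ _ e0)[m _ /(_ m (leqnn m))].
  rewrite mul1r sub0r normrN ger0_norm ?exprn_ge0 ?invr_ge0 ?(ltW p0)// exprVn => /ltW me.
  exists m; split; first by rewrite invr_ge0 exprn_ge0// ltW.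
  by rewrite (le_trans me)// lerDr mulr_ge0// powR_ge0.
have ld0 : 0 <= - ln t by rewrite oppr_ge0 ln_le0.
have /truncn_itv/andP[] : 0 <= - ln t / lam by rewrite divr_ge0// ltW.
set m := Num.truncn _; rewrite ler_pdivlMr// ltr_pdivrMr// => m1 m2.
exists m; split.
  rewrite -ler_ln ?posrE ?invr_gt0 ?exprn_gt0// lnV ?posrE ?exprn_gt0// lnXn//.
  by rewrite lerNr -mulr_natl.
rewrite (@le_trans _ _ (normc b `^ s * t `^ s))//; last by rewrite lerDl ltW.
have p0 : 0 < normc b `^ s by rewrite powR_gt0.
rewrite -ler_pdivrMl// -invfM -exprS.
rewrite -ler_ln ?posrE ?invr_gt0 ?exprn_gt0 ?powR_gt0// lnV ?posrE ?exprn_gt0//.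
rewrite lnXn// !ln_powR -mulr_natl lerNl -mulrN mulrCA ler_wpM2l//.
exact: ltW.
Qed.

(** Each [U k] is replaced by the set [O k] of sequences that share their first
    [l k] letters with a sequence of [A] whose expansion lies in [U k]; it is open, being
    a union of cylinders, so finitely many of them cover [A]. *)
Lemma card_language_renewal (K : nat) (U : nat -> set R[i]^o) (l : nat -> nat) :
  (forall m (U : set R[i]^o), (diam U <= ((normc b ^+ m)^-1)%:E)%E ->
   forall S : {set m.-tuple (digit D)},
    (forall w, w \in S -> exists a, [/\ A a, word a m = w & U (pi a)]) ->
    (#|S| <= K)%N) ->
  expansion b @` A `<=` \bigcup_k U k ->
  (forall k, U k != set0 -> (diam (U k) <= ((normc b ^+ l k)^-1)%:E)%E) ->
  exists k0, forall M, (forall k, (k < k0)%N -> U k != set0 -> (l k <= M)%N) ->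
    (#|language A M| <= \sum_(k < k0 | U k != set0) K * #|language A (M - l k)|)%N.
Proof.
move=> HK AU dU.
pose O k := [set a | exists a', [/\ A a', U k (pi a') & word a (l k) = word a' (l k)]].
have oO k : open (O k).
  rewrite openE => a [a' [Aa' Ua' aa']]; rewrite /interior.
  by have := cylinder_nbhs a (l k); apply: filterS => x xa; exists a'; rewrite xa.
have AO : A `<=` \bigcup_k O k.
  move=> a Aa; have [|k _ Uk] := AU (pi a); first by exists a.
  by exists k => //; exists a.
have [k0 Hk0] := compact_nat_cover (closed_digit_seq_compact (proj1 A_subshift)) oO AO.
exists k0 => M lM.
pose T (k : 'I_k0) := [set w in language A M |
  `[< exists a, [/\ A a, word a M = w & O k a] >]].
apply: (@leq_trans (\sum_(k < k0 | U k != set0) #|T k|)).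
  apply: card_cover_le => w wL; have /languageP[a Aa aw] := wL.
  have [k kk0 Oka] := Hk0 _ Aa.
  exists (Ordinal kk0); last by rewrite inE wL; apply/asboolP; exists a.
  by have [a' [_ Ua' _]] := Oka; apply/set0P; exists (pi a').
apply: leq_sum => k Uk.
pose S := [set v in language A (l k) |
  `[< exists a, [/\ A a, word a (l k) = v & U k (pi a)] >]].
have SK : (#|S| <= K)%N.
  by apply: (HK _ (U k)) => [|v]; [exact: dU|rewrite inE => /andP[_ /asboolP]].
rewrite (leq_trans _ (leq_mul SK (leqnn _)))//.
apply: card_split_le => //; first by rewrite subnKC// lM.
move=> w; rewrite inE => /andP[_ /asboolP[a [Aa aw [a' [Aa' Ua' aa']]]]].
by exists a; split=> //; rewrite inE word_language//; apply/asboolP; exists a'.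
Qed.

(** Furstenberg's argument: a cover with small [s]-sum yields, through
    [card_language_renewal] and [renewal_bound], at most of order
    [|b| ^ (s * M)] words of length [M]. *)
Lemma entropy_le_of_hausdorff_null (s : R) : 0 <= s ->
  hausdorff_measure s (expansion b @` A) = 0%E -> entropy R A <= s * lam.
Proof.
move=> s0 H0; have [K K0 HK] := card_words_meeting R n_ge2 A_neq0.
have Kr : 1 <= K%:R :> R by rewrite ler1n.
have K0' : 0 < K%:R :> R by rewrite ltr0n.
pose rho := normc b `^ s.
have rho0 : 0 < rho by rewrite powR_gt0.
(* With these values the cost of the cylinders is at most
   [K * (rho * eta + e) = 1 / 2]; being less than [1], it excludes the level [0]. *)
pose eta : R := (4 * K%:R * rho)^-1; pose e : R := (4 * K%:R)^-1.
have eta0 : 0 < eta by rewrite invr_gt0 !mulr_gt0.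
have e0 : 0 < e by rewrite invr_gt0 mulr_gt0.
have pre : (hausdorff_premeasure s 1 (expansion b @` A) < eta%:E)%E.
  apply: (@le_lt_trans _ _ 0%E); last by rewrite lte_fin.
  by rewrite -H0; apply: ereal_sup_ubound; exists 1 => //=; exact: ltr01.
have [_ [U [AU dU] <-] sumU] := ereal_inf_lt pre.
have dpow0 k : (0 <= diam_pow s (U k))%E.
  by rewrite /diam_pow; case: ifPn => // _; exact: poweR_ge0.
have /choice[l /= lP] : forall k, exists m, U k != set0 ->
    (diam (U k) <= ((normc b ^+ m)^-1)%:E)%E /\
    ((rho ^+ m)^-1%:E <= rho%:E * diam_pow s (U k) + (e * 2^-1 ^+ k.+1)%:E)%E.
  move=> k; have [Uk|Uk] := boolP (U k == set0); first by exists 0%N.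
  have := dU k; have := diam_ge0 (U k); rewrite /diam_pow (negbTE Uk).
  case: (diam (U k)) => [t||]//; rewrite !lee_fin => t0 t1.
  have ek : 0 < e * 2^-1 ^+ k.+1 by rewrite mulr_gt0// exprn_gt0// invr_gt0.
  have [m [tm mt]] := level_of_diameter s0 t0 t1 ek.
  by exists m => _; rewrite poweR_EFin -EFinM -EFinD !lee_fin.
have [k0 Hk0] := card_language_renewal HK AU (fun k Uk => proj1 (lP k Uk)).
have sum_le : \sum_(k < k0 | U k != set0) K%:R / rho ^+ l k <= 2^-1.
  rewrite -mulr_sumr -ler_pdivlMl//.
  have : ((\sum_(k < k0 | U k != set0) (rho ^+ l k)^-1)%:E <=
      \sum_(k < k0) (rho%:E * diam_pow s (U k) + (e * 2^-1 ^+ k.+1)%:E))%E.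
    rewrite -sumEFin [leRHS](bigID (fun k : 'I_k0 => U k != set0))/=.
    rewrite -[leLHS]adde0; apply: leeD.
      by apply: lee_sum => k Uk; have [_] := lP k Uk.
    apply: sume_ge0 => k _; rewrite adde_ge0 ?mule_ge0 ?lee_fin ?(ltW rho0)//.
    by rewrite mulr_ge0 ?(ltW e0)// exprn_ge0// invr_ge0.
  rewrite big_split/= -ge0_sume_distrr//.
  have sum_eta : (\sum_(k < k0) diam_pow s (U k) <= eta%:E)%E.
    apply: le_trans (ltW sumU); rewrite -(big_mkord xpredT (fun k => diam_pow s (U k))).
    by apply: nneseries_lim_ge => k _ _; exact: dpow0.
  have : (0 <= \sum_(k < k0) diam_pow s (U k))%E by apply: sume_ge0 => k _.
  move: sum_eta; case: (\sum_(k < k0) diam_pow s (U k))%E => [x||]//.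
  rewrite !lee_fin sumEFin -EFinM -EFinD lee_fin -mulr_sumr => xeta x0 h.
  apply: le_trans h _; apply: (@le_trans _ _ (rho * eta + e * 1)).
    by apply: lerD; rewrite ler_wpM2l ?(ltW rho0) ?(ltW e0)// sum_half_le1.
  rewrite /eta /e le_eqVlt; apply/orP; left; apply/eqP; field.
  by rewrite !gt_eqF.
have lgt0 (k : 'I_k0) : U k != set0 -> (0 < l k)%N.
  move=> Uk; rewrite lt0n; apply/negP => /eqP lk0.
  have : K%:R / rho ^+ l k <= 2^-1.
    apply: le_trans sum_le; rewrite (bigD1 k)//= lerDl sumr_ge0// => i _.
    by rewrite divr_ge0// exprn_ge0// ltW.
  rewrite lk0 expr0 divr1 => /(le_trans Kr).
  by rewrite invf_ge1// leNgt ltr1n.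
pose M0 := (\max_(k < k0) l k)%N.
have lM0 (k : 'I_k0) : (l k <= M0)%N by exact: leq_bigmax.
have [B B0 HB] : exists2 B : R, 0 < B & forall M, #|language A M|%:R <= B * rho ^+ M.
  apply: (@renewal_bound R (fun M => #|language A M|%:R) K%:R rho 'I_k0
    (fun k => U k != set0) (fun k => l k) M0) => //.
  - by move=> k Uk; rewrite lgt0//= lM0.
  - by rewrite (le_trans sum_le)// invf_le1// ler1n.
  - move=> M M0M; under eq_bigr do rewrite -natrM; rewrite -natr_sum ler_nat.
    by apply: Hk0 => k kk0 _; apply: leq_trans M0M; exact: (lM0 (Ordinal kk0)).
rewrite leNgt; apply/negP => hs.
have e2 : 0 < (entropy R A - s * lam) / 2 by rewrite divr_gt0// subr_gt0.
have /cvg_ratioP/(_ _ e2) hM := @entropy_cvg R _ _ _ A_neq0 A_subshift.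
pose Bnd := ln B / ((entropy R A - s * lam) / 2).
have [M _ /(_ M (leqnn M)) [HM BM]] : \forall M \near \oo,
    `|log_language R A M - M%:R * entropy R A| <= (entropy R A - s * lam) / 2 * M%:R
    /\ Bnd + 1 <= M%:R.
  near=> M; split; first by near: M.
  by near: M; exact: nbhs_infty_ger.
have : log_language R A M <= ln B + M%:R * (s * lam).
  have L0 : 0 < #|language A M|%:R :> R by rewrite ltr0n language_gt0.
  have -> : ln B + M%:R * (s * lam) = ln (B * rho ^+ M).
    by rewrite lnM ?posrE ?exprn_gt0// lnXn// /rho ln_powR -(mulr_natl (s * lam) M).
  by rewrite ler_ln ?posrE// mulr_gt0// exprn_gt0.
have : ln B < (entropy R A - s * lam) / 2 * M%:R.
  by rewrite mulrC -ltr_pdivrMr// (lt_le_trans _ BM)// ltrDl.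
move: HM; rewrite ler_norml => /andP[low _] up.
exact: growth_contradiction low up.
Unshelve. all: by end_near.
Qed.

(** There are about [exp (M * h)] cylinders of length [M], with [h] the entropy, and
    each contributes about [|b| ^ (- s * M)] to the [s]-sum. *)
Lemma hausdorff_null_of_entropy_lt (s : R) : entropy R A / lam < s ->
  hausdorff_measure s (expansion b @` A) = 0%E.
Proof.
move=> hs; have h0 := entropy_ge0 R A_neq0 A_subshift.
have s0 : 0 < s by apply: le_lt_trans hs; rewrite divr_ge0// ltW.
have C0 : 0 < 2 * expansion_bound (n ^ 2).+1 b.
  by rewrite mulr_gt0// divr_gt0 ?ltr0n// subr_gt0.
set C := 2 * _ in C0.
have dpow0 V : (0 <= diam_pow s V)%E.
  by rewrite /diam_pow; case: ifPn => // _; exact: poweR_ge0.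
apply/eqP; rewrite eq_le; apply/andP; split; last first.
  apply: (@le_trans _ _ (hausdorff_premeasure s 1 (expansion b @` A))).
    by apply: le_ereal_inf_tmp => _ [U _ <-]; exact: nneseries_ge0.
  by apply: ereal_sup_ubound; exists 1 => //=; exact: ltr01.
apply: ge_ereal_sup => _ [delta /= d0 <-].
apply/lee_addgt0Pr => e e0; rewrite add0e.
rewrite ltr_pdivrMr// in hs.
pose e2 := (s * lam - entropy R A) / 2.
have e20 : 0 < e2 by rewrite divr_gt0// subr_gt0.
have /cvg_ratioP/(_ _ e20) hM := @entropy_cvg R _ _ _ A_neq0 A_subshift.
have [M _ /(_ M (leqnn M)) [HM Mdelta Me]] : \forall M \near \oo,
   [/\ `|log_language R A M - M%:R * entropy R A| <= e2 * M%:R,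
    (ln C - ln delta) / lam <= M%:R & (s * ln C - ln e) / e2 <= M%:R].
  near=> M; split; first by near: M.
    by near: M; exact: nbhs_infty_ger.
  by near: M; exact: nbhs_infty_ger.
have L0 : 0 < #|language A M|%:R :> R by rewrite ltr0n language_gt0.
pose r := C / normc b ^+ M.
have r0 : 0 < r by rewrite divr_gt0// exprn_gt0.
have lnr : ln r = ln C - M%:R * lam.
  by rewrite ln_div ?posrE ?exprn_gt0// lnXn// -(mulr_natl lam M).
have rdelta : r <= delta.
  rewrite -ler_ln ?posrE// lnr lerBlDr -lerBlDl -ler_pdivrMr//.
have Lr : #|language A M|%:R * r `^ s <= e.
  rewrite -ler_ln ?posrE ?mulr_gt0 ?powR_gt0// lnM ?posrE ?powR_gt0// ln_powR lnr.
  rewrite ler_pdivrMr// in Me.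
  by move: HM Me; rewrite ler_norml => /andP[_]; exact: growth_exponent.
apply: le_trans (_ : _ <= (#|language A M|%:R * r `^ s)%:E)%E _; last by rewrite lee_fin.
pose U k : set R[i]^o := if insub k is Some i then
  cylinder_image A (enum_val (i : 'I_#|language A M|)) else set0.
apply: (@le_trans _ _ (\sum_(0 <= k <oo) diam_pow s (U k))%E).
  apply: ereal_inf_lbound; exists U => //; split.
    move=> _ [a Aa <-]; have wL := word_language M Aa.
    exists (enum_rank_in wL (word a M)) => //.
    by rewrite /U valK; exists a => //; rewrite /= enum_rankK_in.
  move=> k; rewrite /U; case: insubP => [i _ _|_].
    by apply: le_trans (diam_cylinder_image R n_ge2 _ _) _; rewrite lee_fin.
  by apply: diam_le => //; exact: ltW.
have dU k : (diam_pow s (U k) <= (if (k < #|language A M|)%N then r `^ s else 0)%:E)%E.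
  rewrite /diam_pow; case: ifPn => [_|].
    by rewrite lee_fin; case: ifP => // _; exact: powR_ge0.
  rewrite /U; case: insubP => [i -> _ _|_]; last by rewrite eqxx.
  rewrite -poweR_EFin; apply: gt0_ler_poweR; first exact: ltW.
  - by rewrite in_itv/= diam_ge0 leey.
  - by rewrite in_itv/= lee_fin ltW// leey.
  - exact: diam_cylinder_image.
apply: lime_le; first by apply: is_cvg_nneseries => k _ _.
apply: nearW => j; apply: le_trans (lee_sum _ (fun k _ => dU k)) _.
rewrite sumEFin lee_fin.
exact: sum_prefix_le (powR_ge0 _ _).
Unshelve. all: by end_near.
Qed.

Lemma hausdorff_dim_expansion :
  hausdorff_dim (expansion b @` A) = (entropy R A / lam)%:E.
Proof.
apply/eqP; rewrite eq_le; apply/andP; split.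
  apply/lee_addgt0Pr => e e0; apply: ereal_inf_lbound.
  exists (entropy R A / lam + e) => //; split.
    by rewrite addr_ge0 ?(ltW e0)// divr_ge0 ?(ltW lam0)// entropy_ge0.
  by apply: hausdorff_null_of_entropy_lt; rewrite ltrDl.
apply: le_ereal_inf_tmp => _ [s [s0 H0] <-].
by rewrite lee_fin ler_pdivrMr//; exact: entropy_le_of_hausdorff_null.
Qed.

End HausdorffDimension.

Theorem theorem0p2 (R : realType) (n : nat) (hn : (2 <= n)%N)
    (b : R[i]) (hb : b = Complex (- n%:R) 1)
    (D : {set 'I_(n ^ 2).+1%N}) (hD0 : exists d, d \in D)
    (hD : forall d d' : 'I_(n ^ 2).+1%N, d \in D -> d' \in D ->
      `|(d : nat)%:Z - (d' : nat)%:Z| != 1) :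
  (forall A : set (digit_seq D), A !=set0 -> subshift A ->
     times_invariant D b (expansion b @` A) /\
     (box_dim_exists (expansion b @` A) /\
      box_dim (expansion b @` A) = (entropy R A / ln (ComplexField.Normc.normc b))%:E)) /\
  (forall Y : set R[i]^o, times_invariant D b Y ->
     box_dim_exists Y /\ hausdorff_dim Y = box_dim Y).
Proof.
rewrite {}hb -[Complex _ _]/(base n R); split=> [A A0 sA|Y YT].
  split; first exact: subshift_times_invariant.
  exact: box_dim_expansion.
have [A [A0 sA ->]] := times_invariant_subshift hn hD YT.
have [ex_box box_eq] := box_dim_expansion R hn A0 sA; split=> //.
by rewrite box_eq; exact: hausdorff_dim_expansion.
Qed.
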